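(* Every countable meet-continuous $L$-dcpo $P$ admits a countable family of directed subsets of $P$ that is complete for Scott openness. Consequently, for every finite family $P_1,\ldots,P_n$ of countable meet-continuous $L$-dcpos, \[ \sigma\Bigl(\prod_{i=1}^{n}P_i\Bigr)=\prod_{i=1}^{n}\sigma(P_i). \] No global least elements are assumed.
   Context: All posets and directed sets are nonempty; countable sets may be finite. A subset $D$ of a poset is directed if any two of its elements have a common upper bound in $D$. A dcpo is a poset in which every directed subset has a supremum. Write $\mathord{\downarrow}x=\{y:y\le x\}$ and $\mathord{\downarrow}A=\bigcup_{a\in A}\mathord{\downarrow}a$; sets of the form $\mathord{\downarrow}x$ are called principal ideals. For a dcpo $P$, an upper set $U\subseteq P$ is Scott open if for every directed $D\subseteq P$, $\bigvee D\in U$ implies $D\cap U\neq\emptyset$; the Scott open sets form the Scott topology $\sigma(P)$. A dcpo $P$ is meet-continuous if for every $x\in P$ and every directed $D\subseteq P$, $x\le\bigvee D$ implies $x\in\operatorname{cl}_{\sigma(P)}(\mathord{\downarrow}x\cap\mathord{\downarrow}D)$, where $\operatorname{cl}_{\sigma(P)}$ is closure in the Scott topology. A dcpo $P$ is an $L$-dcpo if every principal ideal $\mathord{\downarrow}r$, $r\in P$, is a complete lattice in its induced order (suprema and infima of all subsets, including the empty one, exist inside $\mathord{\downarrow}r$). A global least element is not required. A family $\mathcal D$ of directed subsets of a dcpo $P$ is complete for Scott openness if an upper set $U\subseteq P$ is Scott open exactly when, for every $D\in\mathcal D$, $\bigvee D\in U$ implies $D\cap U\neq\emptyset$. $\prod_i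 P_i$ carries the coordinatewise order, $\sigma(\prod_i P_i)$ is its Scott topology, and $\prod_i\sigma(P_i)$ denotes the ordinary topological product of the Scott topologies. *)

(* Defs.v *)
From HB Require Import structures.
From mathcomp Require Import all_boot all_order.
From mathcomp Require Import boolp classical_sets functions cardinality filter.
From mathcomp Require Import topology function_spaces.

Set Implicit Arguments.
Unset Strict Implicit.
Unset Printing Implicit Defensive.

Import Order.TTheory.
Local Open Scope classical_set_scope.
Local Open Scope order_scope.

Section Posets.
Context {d : Order.disp_t} (P : porderType d).
Implicit Types (x y r s : P) (A B D U : set P) (F : set (set P)).

Definition directed D :=
  D !=set0 /\ forall x y, D x -> D y -> exists2 z, D z & x <= z /\ y <= z.

Definition dcpo := forall D, directed D -> supremums D !=set0.

Definition principal_ideal r : set P := [set x | x <= r].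

Definition upper_set U := forall x y, U x -> x <= y -> U y.

Definition meets_if_sup_in D U :=
  forall s, supremums D s -> U s -> D `&` U !=set0.

(* This also makes sense when [P] is not a dcpo; directed sets without a
   supremum then impose no condition. *)
Definition scott_open U :=
  upper_set U /\ forall D, directed D -> meets_if_sup_in D U.

Definition complete_for_scott_openness F :=
  forall U, upper_set U ->
    (scott_open U <-> forall D, F D -> meets_if_sup_in D U).

(* [A] is a complete lattice for the induced order: bounds are taken within
   [A]. The case [B = set0] gives the least and greatest elements of [A]. *)
Definition complete_lattice_on A :=
  forall B, B `<=` A ->
    (A `&` ubound B) `&` lbound (A `&` ubound B) !=set0 /\
    (A `&` lbound B) `&` ubound (A `&` lbound B) !=set0.

Definition L_dcpo := dcpo /\ forall r, complete_lattice_on (principal_ideal r).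

Lemma scott_openT : scott_open setT.
Proof.
by split=> // D [[x Dx] _] s _ _; exists x.
Qed.

Lemma scott_openI : setI_closed scott_open.
Proof.
move=> U V [upU sU] [upV sV]; split.
  by move=> x y [Ux Vx] xy; split; [exact: upU xy|exact: upV xy].
move=> D dD s sD [Us Vs].
have [x [Dx Ux]] := sU D dD s sD Us.
have [y [Dy Vy]] := sV D dD s sD Vs.
have [z Dz [xz yz]] := dD.2 x y Dx Dy.
by exists z; split=> //; split; [exact: upU xz|exact: upV yz].
Qed.

Lemma scott_open_bigU (I : Type) (f : I -> set P) :
  (forall i, scott_open (f i)) -> scott_open (\bigcup_i f i).
Proof.
move=> fo; split.
  by move=> x y [i _ fx] xy; exists i => //; exact: (fo i).1 fx xy.
move=> D dD s sD [i _ fs].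
have [x [Dx fx]] := (fo i).2 D dD s sD fs.
by exists x; split=> //; exists i.
Qed.

End Posets.

(* [scott P] is [P] equipped with its Scott topology. *)
Definition scott {d : Order.disp_t} (P : porderType d) : Type := P.

HB.instance Definition _ d (P : porderType d) := Choice.on (scott P).
HB.instance Definition _ d (P : porderType d) :=
  isOpenTopological.Build (scott P)
    (scott_openT P) (@scott_openI d P) (@scott_open_bigU d P).

Definition meet_continuous {d : Order.disp_t} (P : porderType d) :=
  dcpo P /\ forall (x : P) (D : set P) (s : P), directed D -> supremums D s -> x <= s ->
    closure (principal_ideal x `&` down D : set (scott P)) x.

(* The library only orders non-dependent function spaces. *)
Definition poset_prod {I : Type} {d : I -> Order.disp_t}
  (P : forall i, porderType (d i)) : Type := forall i, P i.

Section ProductOrder.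
Context {I : Type} {d : I -> Order.disp_t} (P : forall i, porderType (d i)).
Implicit Types f g h : poset_prod P.

HB.instance Definition _ := Choice.on (poset_prod P).

Definition le_prod f g := `[< forall i, f i <= g i >].

Lemma le_prod_refl : reflexive le_prod.
Proof. by move=> f; apply/asboolP => i. Qed.

Lemma le_prod_anti : antisymmetric le_prod.
Proof.
move=> f g /andP[/asboolP fg /asboolP gf].
by apply: functional_extensionality_dep => i; apply/le_anti; rewrite fg gf.
Qed.

Lemma le_prod_trans : transitive le_prod.
Proof.
move=> g f h /asboolP fg /asboolP gh; apply/asboolP => i.
exact: le_trans (fg i) (gh i).
Qed.

HB.instance Definition _ := Order.Le_isPOrder.Build (Order.Disp tt tt)
  (poset_prod P) le_prod_refl le_prod_anti le_prod_trans.

End ProductOrder.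

(* Main.v *)
(* Let [D] be directed with supremum [x] in the upper set [U], and suppose that
   [D] misses [U]. For [c] in [D] and [u <= x] in [U], the set
   [G = down u `&` down D] is directed with supremum [u], by meet-continuity,
   and no [v] in [G] satisfies [u <= c \/ v], the join being taken in [down x].
   The countable family picks one set [G] with these two properties for each
   triple [(x, c, u)] that has one. If [U] meets each picked set whose supremum
   is in [U], then sequences [c_n] increasing in [D] and [u_n] decreasing in [U]
   can be chosen with [u_n] not below [c_n \/ u_(n+1)], so that some
   [d >= c_n] in [D] has [d /\ u_n] not below [c_n \/ u_(n+1)]. Taking [c_(n+1)]
   to be [c_n] or [d], the join of all [c_(n+1) /\ u_n] is made to differ from
   the [n]-th element of the countable poset, a contradiction.

   For products, a point of a Scott open [U] is enlarged to a box in [U] by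
   adding points to a finite grid inside [U]; each member of the countable
   families is treated at some stage, which makes the sides of the box Scott
   open. *)

Require Import Defs.
From mathcomp Require Import all_boot all_order.
From mathcomp Require Import boolp classical_sets functions cardinality filter.
From mathcomp Require Import topology function_spaces.

Local Open Scope classical_set_scope.

Import Order.TTheory.

Set Implicit Arguments.
Unset Strict Implicit.
Unset Printing Implicit Defensive.

(** Dependent choice, with an invariant [V] and a relation that varies with the stage. *)
Lemma iterated_choice {T : Type} (V : set T) (R : nat -> T -> T -> Prop) x0 :
  V x0 -> (forall n x, V x -> exists2 y, V y & R n x y) ->
  exists f : nat -> T, [/\ f 0 = x0, forall n, V (f n) &
    forall n, R n (f n) (f n.+1)].
Proof.
move=> V0 step.
have /choice[g gP] (nx : nat * T) :
    exists y, V nx.2 -> V y /\ R nx.1 nx.2 y.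
  have [/(step nx.1)[y Vy Ry]|] := EM (V nx.2); first by exists y.
  by exists nx.2.
pose f := nat_rect (fun=> T) x0 (fun n x => g (n, x)).
have Vf n : V (f n) by elim: n => //= n /(gP (n, _))[].
by exists f; split=> // n; have [] := gP (n, f n) (Vf n).
Qed.

(** * A countable complete family for a countable meet-continuous L-dcpo *)

Section CountableLDcpo.
Context {d : Order.disp_t} {P : porderType d}.
Implicit Types (x c u v w s : P) (D G U : set P).
Local Open Scope order_scope.

Lemma scott_open_notle s : scott_open [set x | ~ x <= s].
Proof.
split=> [x y /= xs xy ys|D dD t [_ tD] /= ts]; first exact/xs/(le_trans xy).
apply: contrapT => D0; apply/ts/tD => y Dy; apply: contrapT => ys.
by apply: D0; exists y.
Qed.

(** Whatever lies below [x] lies in [principal_ideal s], so the infimum taken there is one in the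
    whole poset. *)
Lemma L_dcpo_meet s x y : L_dcpo P -> x <= s -> y <= s ->
  exists m, [/\ m <= x, m <= y & forall t, t <= x -> t <= y -> t <= m].
Proof.
move=> [_ /(_ s) latP] xs ys.
have [|_ [m [[ms mlb] mub]]] := latP [set x; y]; first by move=> z /= [->|->].
exists m; split; [by apply: mlb; left|by apply: mlb; right|].
move=> t tx ty; apply: mub; split; first exact: le_trans tx xs.
by move=> z [->|->].
Qed.

Lemma L_dcpo_join s D : L_dcpo P -> ubound D s ->
  exists m, ubound D m /\ forall w, w <= s -> ubound D w -> m <= w.
Proof.
move=> [_ /(_ s) latP] Ds.
have [//|[m [[ms mub] mlb]] _] := latP D.
by exists m; split=> // w ws Dw; apply: mlb.
Qed.

(** For an upper bound [b] not above [u], the complement of the principal ideal of [b] would be a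
    Scott open neighbourhood of [u] missing the set. *)
Lemma meet_continuous_sup D s u :
  meet_continuous P -> directed D -> supremums D s -> u <= s ->
  supremums (principal_ideal u `&` down D) u.
Proof.
move=> [_ mc] dD sD us; split=> [x []//|b Gb].
apply: contrapT => ub.
have [] := mc u D s dD sD us [set x : scott P | ~ (x : P) <= b].
  by apply: open_nbhs_nbhs; split=> //; exact: scott_open_notle.
by move=> x [/Gb xb]; apply.
Qed.

Lemma directed_meet D s u : L_dcpo P -> directed D -> ubound D s -> u <= s ->
  directed (principal_ideal u `&` down D).
Proof.
move=> LP [[e De] dD] Ds us; split.
  have [m [mu me _]] := L_dcpo_meet LP us (Ds _ De).
  by exists m; split=> //; exists e.
move=> x y [/= xu [a [Da xa]]] [/= yu [b [Db yb]]].
have [z Dz [az bz]] := dD a b Da Db.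
have [m [mu mz mP]] := L_dcpo_meet LP us (Ds _ Dz).
exists m; first by split=> //; exists z.
by split; apply: mP => //; [exact: le_trans xa az|exact: le_trans yb bz].
Qed.

(* In the complete lattice [principal_ideal x], the last clause says that
   [u] is not below the join of [c] and [v]. *)
Definition escape x c u G :=
  [/\ directed G, supremums G u & forall v, G v ->
     exists w, [/\ w <= x, c <= w, v <= w & ~ u <= w]].

Lemma escape_meet x c u D U : L_dcpo P -> meet_continuous P ->
  upper_set U -> directed D -> supremums D x -> ~ (D `&` U !=set0) ->
  D c -> U u -> u <= x -> escape x c u (principal_ideal u `&` down D).
Proof.
move=> LP mc upU dD sD DU0 Dc Uu ux; split.
- exact: directed_meet sD.1 ux.
- exact: meet_continuous_sup ux.
- move=> v [_ [e [De ve]]]; have [w Dw [cw ew]] := dD.2 c e Dc De.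
  exists w; split=> //; [exact: sD.1|exact: le_trans ew|] => uw.
  by apply: DU0; exists w; split=> //; exact: upU uw.
Qed.

(* The element [y] is the join of the meets of [(f n.+1).1] and [(f n).2] for
   sequences increasing in [D] and decreasing in [U]; stage [n] of their
   construction makes [y] different from the element with code [n]. *)
Lemma no_diagonal x D U : L_dcpo P -> meet_continuous P ->
  countable [set: P] -> directed D -> supremums D x -> U x ->
  (forall c u, D c -> U u -> u <= x -> exists v w,
    [/\ U v, v <= u & [/\ w <= x, c <= w, v <= w & ~ u <= w]]) -> False.
Proof.
move=> LP mc /countable_injP[code code_inj] dD sD Ux next.
pose V := [set cu : P * P | [/\ D cu.1, U cu.2 & cu.2 <= x]].
(* The join [y] built below lies under [w] in the first case and above [t] in the second; either
   excludes [y = p]. *)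
pose R n (a b : P * P) := [/\ a.1 <= b.1, b.2 <= a.2 & forall p, code p = n ->
  (exists w, [/\ w <= x, b.1 <= w, b.2 <= w & ~ p <= w]) \/
  (exists t, [/\ t <= b.1, t <= a.2 & ~ t <= p])].
have [c0 Dc0] := dD.1.
have [||f [_ Vf Rf]] := @iterated_choice _ V R (c0, x).
- by split.
- move=> n [c u] [/= Dc Uu ux].
  have [v [w [Uv vu [wx cw vw uw]]]] := next c u Dc Uu ux.
  have [t [[/= tu [e [De te]]] tw]] :
      exists t, (principal_ideal u `&` down D) t /\ ~ t <= w.
    apply: contrapT => H; apply: uw.
    apply: (meet_continuous_sup mc dD sD ux).2 => t Gt.
    by apply: contrapT => tw; apply: H; exists t.
  have vx : v <= x := le_trans vu ux.
  (* If the element with code [n] is above [t], it is not below [w], and [c] is kept; otherwise [c]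
     is raised to lie above [t]. *)
  have [[p [<- tp]]|none] := EM (exists p, code p = n /\ t <= p).
    exists (c, v); split=> //= q.
    move/(code_inj q p (in_setT _) (in_setT _)) ->.
    by left; exists w; split=> // pw; exact/tw/(le_trans tp).
  have [c' Dc' [cc' ec']] := dD.2 c e Dc De.
  exists (c', v); split=> //= p pn; right; exists t; split=> //.
    exact: le_trans ec'.
  by move=> tp; apply: none; exists p.
have fhomo1 : {homo (fun n => (f n).1) : m n / (m <= n)%N >-> m <= n}.
  by apply: homo_leq => // [? ? ?|n]; [exact: le_trans|case: (Rf n)].
have fhomo2 : {homo (fun n => (f n).2) : m n / (m <= n)%N >-> n <= m}.
  apply: (@homo_leq _ (fun n => (f n).2) (fun a b => b <= a)) => //.
    by move=> a b c ba cb; exact: le_trans cb ba.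
  by move=> n; case: (Rf n).
have [|y [yub ylub]] := @L_dcpo_join x
    [set t | exists n, t <= (f n.+1).1 /\ t <= (f n).2] LP.
  by move=> t [n [_ /le_trans]]; apply; case: (Vf n).
have [_ _ /(_ y erefl)[[w [wx cw uw]]|[t [tc tu]]]] := Rf (code y); apply.
  (* Terms up to stage [code y] are below [w] through their increasing first bound, later ones
     through their decreasing second bound. *)
  apply: ylub => // t [m [tc tu]]; have [mn|nm] := leqP m (code y).
    by apply: le_trans cw; apply: le_trans tc _; exact: fhomo1.
  by apply: le_trans uw; apply: le_trans tu _; exact: fhomo2.
by apply: yub; exists (code y).
Qed.

Lemma countable_complete_family : countable [set: P] -> L_dcpo P ->
  meet_continuous P -> exists F : set (set P),
    [/\ countable F, (forall D, F D -> directed D) &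
        complete_for_scott_openness F].
Proof.
move=> cP LP mc.
have /choice[G GP] (q : P * P * P) :
    exists G, (exists G', escape q.1.1 q.1.2 q.2 G') ->
              escape q.1.1 q.1.2 q.2 G.
  by have [[G HG]|] := EM (exists G', escape q.1.1 q.1.2 q.2 G');
    [exists G|exists set0].
(* The index set leaves out the triples given the default [set0], which is not directed. *)
exists (G @` [set q | exists G', escape q.1.1 q.1.2 q.2 G']); split.
- apply: sub_countable (card_image_le _ _) _.
  apply: (@sub_countable _ _ _ [set: P * P * P]).
    by apply: subset_card_le => ?.
  have -> : [set: P * P * P] = [set: P] `*` [set: P] `*` [set: P].
    by apply/seteqP; split.
  by do 2![apply: countableX => //].
- by move=> _ [q /GP[dG _ _] <-].
move=> U upU; split=> [[_ oU] _ [q /GP[dG _ _] <-]|FU]; first exact: oU.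
split=> // D dD x sD Ux; apply: contrapT => DU0.
apply: (@no_diagonal x D U) => // c u Dc Uu ux.
have ex : exists G', escape x c u G'.
  by exists (principal_ideal u `&` down D); exact: escape_meet DU0 Dc Uu ux.
have [dG sG Gw] := GP (x, c, u) ex.
have [|v [Gv Uv]] := FU (G (x, c, u)) _ u sG Uu; first by exists (x, c, u).
have [w wP] := Gw v Gv.
by exists v, w; split=> //; exact: sG.1.
Qed.

End CountableLDcpo.

(** * Boxes inside Scott open sets of finite products *)

Lemma directed_forall {d : Order.disp_t} {P : porderType d} {T : finType}
    (D : set P) (Q : T -> set P) :
  directed D -> (forall t, exists x, D x /\ Q t x) ->
  (forall t, upper_set (Q t)) -> exists x, D x /\ forall t, Q t x.
Proof.
move=> dD DQ upQ.
suff [x [Dx xQ]] : exists x, D x /\ forall t, t \in enum T -> Q t x.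
  by exists x; split=> // t; apply: xQ; rewrite mem_enum.
elim: (enum T) => [|t l [x [Dx xQ]]]; first by have [x Dx] := dD.1; exists x.
have [y [Dy yQ]] := DQ t; have [z Dz [xz yz]] := dD.2 x y Dx Dy.
exists z; split=> // t'; rewrite inE => /orP[/eqP ->|/xQ Qx].
  exact: upQ yQ yz.
exact: upQ Qx xz.
Qed.

Section FiniteProduct.
Context {I : finType} {d : I -> Order.disp_t} {P : forall i, porderType (d i)}.
Implicit Types (a b e f g : poset_prod P) (h : seq (poset_prod P)).
Local Open Scope order_scope.

Lemma le_prodP f g : f <= g <-> forall i, f i <= g i.
Proof. by split=> [/asboolP //|fg]; apply/asboolP. Qed.

Lemma directed_proj (D : set (poset_prod P)) i :
  directed D -> directed ((fun f => f i) @` D).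
Proof.
move=> [[f Df] dD]; split; first by exists (f i), f.
move=> _ _ [g Dg <-] [k Dk <-];
have [e De [/le_prodP ge /le_prodP ke]] := dD _ _ Dg Dk.
by exists (e i) => //; exists e.
Qed.

(** The tuple of coordinatewise suprema is also a supremum of [D], hence equal to [s]. *)
Lemma supremums_proj (D : set (poset_prod P)) (s : poset_prod P) i :
  (forall j, dcpo (P j)) -> directed D -> supremums D s ->
  supremums ((fun f => f i) @` D) (s i).
Proof.
move=> cP dD [sub slub].
have supP j : exists t, supremums ((fun f => f j) @` D) t.
  by have [t] := cP j _ (directed_proj j dD); exists t.
pose t : poset_prod P := fun j => xget (s j) (supremums ((fun f => f j) @` D)).
have tP j : supremums ((fun f => f j) @` D) (t j) by exact: xgetPex (supP j).
suff <- : t = s by [].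
apply/le_anti/andP; split; last first.
  by apply: slub => f Df; apply/le_prodP => j; apply: (tP j).1; exists f.
apply/le_prodP => j; apply: (tP j).2 => _ [f /sub/le_prodP fs <-].
exact: fs.
Qed.

Lemma scott_open_proj i (V : set (P i)) : (forall j, dcpo (P j)) ->
  scott_open V -> scott_open [set f : poset_prod P | V (f i)].
Proof.
move=> cP [upV oV]; split=> [f g /= Vf /le_prodP fg|D dD s sD /= Vs].
  exact: upV (fg i).
have [_ [[f Df <-] Vf]] :=
  oV _ (directed_proj i dD) _ (supremums_proj i cP dD sD) Vs.
by exists f.
Qed.

(** The list encodes a finite grid: side [i] consists of the [i]-th coordinates of its members, and
    [g] selects a grid point. *)
Definition grid_in (U : set (poset_prod P)) h :=
  forall g : I -> poset_prod P, (forall i, g i \in h) -> U (fun i => g i i).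

(** Moving coordinate [i] of a row through [D] gives a directed set whose supremum is above a grid
    point, hence in [U]; one [x] in [D] serves the finitely many rows. *)
Lemma grid_in_extend (U : set (poset_prod P)) h b i (D : set (P i)) (s : P i) :
  scott_open U -> directed D -> supremums D s -> grid_in U h -> b \in h ->
  b i <= s -> exists2 e : poset_prod P, D (e i) & grid_in U (e :: h).
Proof.
move=> [upU oU] dD sD gU bh bs.
pose row (k : {ffun I -> 'I_(size h)}) : poset_prod P :=
  fun j => nth b h (k j) j.
have [k|k x y /= Ux xy|x [Dx Ux]] := @directed_forall _ _ _ D
    (fun k => [set x | U (dfwith (row k) x : poset_prod P)]) dD.
- have sE : supremums
      ((fun x => dfwith (row k) x : poset_prod P) @` D) (dfwith (row k) s).
    split=> [_ [x Dx <-]|f fub]; apply/le_prodP => j.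
      by case: dfwithP => [|l il]; rewrite ?dfwith_in ?dfwith_out//; exact: sD.1.
    case: dfwithP => [|l il].
      apply: sD.2 => x Dx.
      have /le_prodP/(_ i) : dfwith (row k) x <= f :> poset_prod P.
        by apply: fub; exists x.
      by rewrite dfwith_in.
    have [x Dx] := dD.1.
    have /le_prodP/(_ l) : dfwith (row k) x <= f :> poset_prod P.
      by apply: fub; exists x.
    by rewrite dfwith_out.
  have [||_ [[x Dx <-] Ux]] := oU _ _ _ sE.
  + split; first by have [x Dx] := dD.1; exists (dfwith (row k) x), x.
    move=> _ _ [x Dx <-] [y Dy <-]; have [z Dz [xz yz]] := dD.2 x y Dx Dy.
    exists (dfwith (row k) z); first by exists z.
    by split; apply/le_prodP => j; case: dfwithP => [|l il];
      rewrite ?dfwith_in ?dfwith_out.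
  + apply: upU (gU (fun j => if j == i then b else nth b h (k j)) _) _.
      by move=> j; case: ifP => // _; exact: mem_nth.
    apply/le_prodP => j; case: dfwithP => [|l il]; first by rewrite eqxx.
    by rewrite eq_sym (negbTE il).
  + by exists x.
- apply: upU Ux _; apply/le_prodP => j.
  by case: dfwithP => [|l il]; rewrite ?dfwith_in ?dfwith_out.
(* Off [i] this tuple agrees with [b], so only side [i] of the grid gains a point. *)
exists (dfwith b x); first by rewrite dfwith_in.
move=> g gh; pose g' j := if g j \in h then g j else b.
have g'h j : g' j \in h by rewrite /g'; case: ifP.
have g'E j : i != j -> g' j j = g j j.
  move=> ij; rewrite /g'; case: ifPn => // gj; have := gh j.
  by rewrite inE (negbTE gj) orbF => /eqP ->; rewrite dfwith_out.
have [gi|gi] := boolP (g i \in h).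
  suff -> : (fun j => g j j) = (fun j => g' j j) by exact: gU.
  apply: functional_extensionality_dep => j.
  by have [<-|/g'E//] := eqVneq i j; rewrite /g' gi.
pose k := [ffun j => Ordinal (etrans (index_mem (g' j) h) (g'h j))].
suff -> : (fun j => g j j) = dfwith (row k) x by exact: Ux.
apply: functional_extensionality_dep => j; case: dfwithP => [|l il].
  by have := gh i; rewrite inE (negbTE gi) orbF => /eqP ->; rewrite dfwith_in.
by rewrite /row ffunE /= nth_index// g'E.
Qed.

Lemma grid_in_extends (U : set (poset_prod P)) (F : forall i, set (set (P i)))
    (code : forall i, set (P i) -> nat) h (l : seq (I * nat)) :
  scott_open U -> (forall i D, F i D -> directed D) ->
  (forall i, {in F i &, injective (code i)}) -> grid_in U h ->
  exists h', [/\ grid_in U h', {subset h <= h'} &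
    forall i D s b, (i, code i D) \in l -> F i D -> supremums D s ->
      b \in h -> b i <= s -> exists2 e, e \in h' & D (e i)].
Proof.
move=> oU dF codeI gU; elim: l => [|[i m] l [h' [gU' hh' h'P]]].
  by exists h; split=> // ? ? ? ?; rewrite inE.
(* One new point per [D] suffices, since the condition [D (e i)] involves neither [s] nor [b]. *)
have [[D [s [b [FD cD sD bh bs]]]]|none] := EM (exists D s (b : poset_prod P),
    [/\ F i D, code i D = m, supremums D s, b \in h & b i <= s]).
  have [e De eU] := grid_in_extend oU (dF _ _ FD) sD gU' (hh' _ bh) bs.
  exists (e :: h'); split=> //; first by move=> f /hh' fh; rewrite inE fh orbT.
  move=> j E t c; rewrite inE => /orP[/eqP[ji cE]|lE] FE sE ch ct.
    subst j; have -> : E = D by apply: codeI; rewrite ?inE// cE.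
    by exists e => //; rewrite inE eqxx.
  have [f fh Ef] := h'P j E t c lE FE sE ch ct.
  by exists f => //; rewrite inE fh orbT.
exists h'; split=> // j E t c; rewrite inE => /orP[/eqP[ji cE]|];
  last exact: h'P.
subst j => FE sE ch ct; exfalso; apply: none.
by exists E, t, c.
Qed.

Lemma scott_open_box (U : set (poset_prod P))
    (F : forall i, set (set (P i))) a :
  scott_open U -> (forall i, countable (F i)) ->
  (forall i D, F i D -> directed D) ->
  (forall i, complete_for_scott_openness (F i)) -> U a ->
  exists V : forall i, set (P i), [/\ forall i, scott_open (V i),
    forall i, V i (a i) & forall f, (forall i, V i (f i)) -> U f].
Proof.
move=> oU cF dF complF Ua.
have codes i : exists f : set (P i) -> nat, {in F i &, injective f}.
  exact/countable_injP.
pose code i := sval (cid (codes i)).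
have codeI i : {in F i &, injective (code i)} := svalP (cid (codes i)).
(* Stage [k] treats every [D] with code at most [k], so each [D] is treated again for points added
   later. *)
pose R k h h' := {subset h <= h'} /\ forall i D s b, (code i D <= k)%N ->
  F i D -> supremums D s -> b \in h -> b i <= s ->
  exists2 e : poset_prod P, e \in h' & D (e i).
have [||h [h0 gU hR]] := @iterated_choice _ (grid_in U) R [:: a].
- move=> g ga; suff -> : (fun i => g i i) = a by [].
  apply: functional_extensionality_dep => i.
  by have := ga i; rewrite inE => /eqP ->.
- move=> k h gU.
  have [h' [gU' hh' h'P]] := grid_in_extends
    [seq (i, m) | i <- enum I, m <- iota 0 k.+1] oU dF codeI gU.
  exists h' => //; split=> // i D s b ck; apply: h'P.
  by apply/allpairsP; exists (i, code i D); rewrite mem_enum mem_iota.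
have hhomo : {homo h : m n / (m <= n)%N >-> {subset m <= n}}.
  apply: homo_leq => [x y //|x y z yx xz f /yx/xz//|n].
  by have [] := hR n.
pose V i := [set p | exists k b, b \in h k /\ b i <= p].
have upV i : upper_set (V i).
  by move=> p q [k [b [bk bp]]] pq; exists k, b; split=> //; exact: le_trans pq.
exists V; split=> [i|i|f Vf].
- apply/(complF i _ (upV i)) => D FD s sD [k [b [bk bs]]].
  have bk' : b \in h (maxn k (code i D)) by exact: hhomo (leq_maxl _ _) _ bk.
  have [e eh De] := (hR _).2 i D s b (leq_maxr _ _) FD sD bk' bs.
  by exists (e i); split=> //; exists (maxn k (code i D)).+1, e.
- by exists 0, a; rewrite h0 inE eqxx.
have /all_sig[k kP] i : {k | exists b, b \in h k /\ b i <= f i}.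
  by apply: cid; exact: Vf.
have /all_sig[g gP] i := cid (kP i).
(* Since [I] is finite, all the [g i] lie in the grid of one stage. *)
apply: oU.1 (gU (\max_i k i) g _) _.
  by move=> i; apply: hhomo (gP i).1; exact: leq_bigmax.
by apply/le_prodP => i; exact: (gP i).2.
Qed.

End FiniteProduct.

(** The projections generate the product topology, and they are Scott continuous. *)
Lemma scott_prod_open {I : finType} {d : I -> Order.disp_t}
    {P : forall i, porderType (d i)} (U : set (forall i, P i)) :
  (forall i, dcpo (P i)) ->
  @open (prod_topology (fun i => scott (P i))) U ->
  scott_open (U : set (poset_prod P)).
Proof.
move=> cP; rewrite openE => oU.
suff : @open (scott (poset_prod P)) U by [].
rewrite openE => a /oU.
suff : nbhs (a : scott (poset_prod P)) -->
       (a : prod_topology (fun i => scott (P i))) by apply.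
apply/cvg_sup => i A; rewrite nbhsE => -[B [[V oV <-] Va] BA].
apply: filterS BA _; apply: open_nbhs_nbhs; split=> //.
exact: scott_open_proj.
Qed.

Theorem theorem3p4 :
  (forall (d : Order.disp_t) (P : porderType d),
     [set: P] !=set0 -> countable [set: P] ->
     L_dcpo P -> meet_continuous P ->
     exists F : set (set P),
       [/\ countable F, (forall D, F D -> directed D) &
           complete_for_scott_openness F]) /\
  (forall (n : nat) (d : 'I_n -> Order.disp_t)
          (P : forall i : 'I_n, porderType (d i)),
     (forall i, [set: P i] !=set0) -> (forall i, countable [set: P i]) ->
     (forall i, L_dcpo (P i)) -> (forall i, meet_continuous (P i)) ->
     (@open (scott (poset_prod P)) : set (set (forall i, P i))) =
     @open (prod_topology (fun i => scott (P i)))).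
Proof.
split=> [d P _|n d P _ cP LP mc]; first exact: countable_complete_family.
apply/seteqP; split=> U oU; last first.
  by apply: scott_prod_open oU => i; case: (LP i).
have /all_sig[F /all_and3[cF dF complF]] i :
    {F | [/\ countable F, forall D : set (P i), F D -> directed D &
             complete_for_scott_openness F]}.
  by apply: cid; exact: countable_complete_family.
rewrite openE => a Ua.
have [V [oV Va VU]] := scott_open_box oU cF dF complF Ua.
have fa := nbhs_filter (a : prod_topology (fun i => scott (P i))).
apply: (@filterS _ _ fa _ _ VU).
apply: (@filter_forall _ _ (fun i f => V i (f i)) _ fa) => i.
apply: (@proj_continuous _ (fun i => scott (P i))).
by apply: open_nbhs_nbhs; split; [exact: oV|exact: Va].
Qed.
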